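(* Let $\mathcal{N}=\{X_n(k)\mid k\in[0,k_{max}]\}$ be a closed natural motion trajectory, let $\rho_k\ge 0$ be scale factors and let $\mathcal{T}_{\mathcal{N}}=\bigcup_{k\in[0,k_{max}]}\mathcal{E}_{k,\mathcal{N}}$ with $\mathcal{E}_{k,\mathcal{N}}=\{X\in\mathbb{R}^6\mid (X-X_n(k))^TP(X-X_n(k))\le\rho_k\}$. Suppose that (A1) the closed-loop dynamics are $X(k+1)=\bar{A}X(k)-BKX_n(k+\delta)$ and the error dynamics are $e(k+1)=\bar{A}e(k)$, where $e(k)=X(k)-X_n(k+\delta)$ and $\bar A=A+BK$; and (A2) $P=P^T>0$ is chosen such that $\bar{A}^TP\bar{A}-P=-Q$ with $Q=Q^T>0$. Then the tube $\mathcal{T}_{\mathcal{N}}$ is positively-invariant if $$\rho_{k_1}\le\rho_{k_2}\quad\text{whenever } k_1\le k_2,\qquad k_1,k_2\in\mathbb{Z}_{\ge 0},$$ where indices exceeding $k_{max}$ are reduced modulo $k_{max}+1$.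
   Context: Dynamics: $X=[x\ y\ z\ \dot x\ \dot y\ \dot z]^T\in\mathbb{R}^6$, $X(k+1)=AX(k)+Bu(k)$, $k\in\mathbb{Z}_{\ge0}$, $u(k)\in\mathbb{R}^3$, with $\Delta T>0$, $m>0$, $\omega>0$ and $A=\exp(A_c\Delta T)$, $B=\int_0^{\Delta T}\exp(A_c(\Delta T-s))\,ds\begin{bmatrix}0_{3\times3}\\ \frac1m I_{3\times3}\end{bmatrix}$, $$A_c=\begin{bmatrix}0&0&0&1&0&0\\0&0&0&0&1&0\\0&0&0&0&0&1\\3\omega^2&0&0&0&2\omega&0\\0&0&0&-2\omega&0&0\\0&0&-\omega^2&0&0&0\end{bmatrix}$$ (Clohessy-Wiltshire equations). $\Delta T$ is chosen so that $\tau/\Delta T\in\mathbb{Z}_{>0}$, where $\tau=2\pi/\omega$, and $k_{max}=\tau/\Delta T-1$. Closed natural motion trajectory (NMT): for an initial condition $\bar X_0$ whose components satisfy $\dot y(0)=-2\omega x(0)$, $\mathcal{N}=\{X_n(k)\mid X_n(0)=\bar X_0,\ X_n(k+1)=AX_n(k),\ k\in[0,k_{max}]\}$. The sequence is periodic, $X_n(k_{max}+1)=X_n(0)$. Here $[0,k_{max}]$ denotes integers, and any index $k$ (of $X_n(k)$, $\rho_k$, $\mathcal{E}_{k,\mathcal{N}}$) outside $[0,k_{max}]$ is taken to be the equivalent index in $[0,k_{max}]$ modulo $k_{max}+1$. Control: $u(k)=K(X(k)-X_n(k+\delta))$, where $\delta\in\mathbb{Z}$ is a shift and $K$ is a gain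 matrix for which $\bar A=A+BK$ is Schur (all eigenvalues in the open unit disk). Positive invariance: $\mathcal{T}_{\mathcal{N}}$ is positively-invariant with respect to the closed-loop dynamics if there exists $\delta\in\mathbb{Z}$ such that, for every $k_1\in\mathbb{Z}_{\ge0}$ and every sequence $(X(k))_{k\ge k_1}$ satisfying $X(k+1)=\bar AX(k)-BKX_n(k+\delta)$ for $k\ge k_1$, $X(k_1)\in\mathcal{E}_{k_1+\delta,\mathcal{N}}$ implies $X(k_2)\in\mathcal{E}_{k_2+\delta,\mathcal{N}}$ for all integers $k_2\ge k_1$. *)

(* Defs.v *)
From HB Require Import structures.
From mathcomp Require Import all_boot all_order all_algebra.
From mathcomp Require Import all_classical all_reals all_analysis.
From mathcomp Require Import complex.

Set Implicit Arguments.
Unset Strict Implicit.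
Unset Printing Implicit Defensive.

Import Order.TTheory GRing.Theory Num.Theory.
Import numFieldNormedType.Exports.

Local Open Scope classical_set_scope.
Local Open Scope ring_scope.

Section LinearAlgebra.
Variable R : realType.

Definition expmx n (M : 'M[R]_n.+1) : 'M[R]_n.+1 :=
  limn (series (fun k => (k`!%:R)^-1 *: M ^+ k)).

Definition schur n (M : 'M[R]_n) : Prop :=
  forall l : R[i], eigenvalue (map_mx (real_complex R) M) l -> `|l| < 1.

Definition quad n (P : 'M[R]_n) (v : 'cV[R]_n) : R := (v^T *m P *m v) 0 0.

Definition sym_posdef n (P : 'M[R]_n) : Prop :=
  P = P^T /\ forall v : 'cV[R]_n, v != 0 -> 0 < quad P v.

End LinearAlgebra.

Section ClohessyWiltshire.
Variable R : realType.

Definition cw_rows (omega : R) : seq (seq R) :=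
  [:: [:: 0; 0; 0; 1; 0; 0];
      [:: 0; 0; 0; 0; 1; 0];
      [:: 0; 0; 0; 0; 0; 1];
      [:: 3 * omega ^+ 2; 0; 0; 0; 2 * omega; 0];
      [:: 0; 0; 0; - (2 * omega); 0; 0];
      [:: 0; 0; - omega ^+ 2; 0; 0; 0]].

Definition cw_Ac (omega : R) : 'M[R]_6 :=
  \matrix_(i < 6, j < 6) nth 0 (nth [::] (cw_rows omega) i) j.

Definition cw_A (omega dT : R) : 'M[R]_6 := expmx (dT *: cw_Ac omega).

Definition cw_input (m : R) : 'M[R]_(6, 3) :=
  col_mx (0 : 'M[R]_3) (m^-1 *: (1%:M : 'M[R]_3)).

Definition cw_B (omega m dT : R) : 'M[R]_(6, 3) :=
  (\matrix_(i < 6, j < 6)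
      \int[lebesgue_measure]_(s in `[0, dT])
         expmx ((dT - s) *: cw_Ac omega) i j)
  *m cw_input m.

(* The state is (x, y, z, x', y', z'), so this reads y'(0) = - 2 omega x(0). *)
Definition closed_nmt_init (omega : R) (X0 : 'cV[R]_6) : Prop :=
  X0 (inord 4) 0 = - (2 * omega * X0 (inord 0) 0).

End ClohessyWiltshire.

Section Tube.
Variables (R : realType) (kmax : nat).
Implicit Types (A P : 'M[R]_6) (B : 'M[R]_(6, 3)) (K : 'M[R]_(3, 6)).
Implicit Types (X : 'cV[R]_6) (rho : 'I_kmax.+1 -> R).

(* The representative of k in [0, kmax] modulo kmax + 1. *)
Definition index_mod (k : int) : 'I_kmax.+1 := inord `|(k %% kmax.+1%:Z)%Z|%N.

(* Only the index is reduced: A X_n(kmax) = X_n(0) is not built in. *)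
Definition nmt A (X0 : 'cV[R]_6) (k : int) : 'cV[R]_6 :=
  iter (index_mod k) (mulmx A) X0.

Definition tube_section A (X0 : 'cV[R]_6) P rho (k : int) : set 'cV[R]_6 :=
  [set X | quad P (X - nmt A X0 k) <= rho (index_mod k)].

Definition tube (E : int -> set 'cV[R]_6) : set 'cV[R]_6 :=
  \bigcup_(k : 'I_kmax.+1) E (k : nat)%:Z.

Definition closed_loop A B K (Xn : int -> 'cV[R]_6) (delta : int)
    (k1 : nat) (X : nat -> 'cV[R]_6) : Prop :=
  forall k : nat, (k1 <= k)%N ->
    X k.+1 = (A + B *m K) *m X k - B *m K *m Xn (k%:Z + delta).

(* Positive invariance of [tube E]: a property of the decomposition of the tube
   into sections, not only of the union. *)
Definition tube_positively_invariant A B K (Xn : int -> 'cV[R]_6)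
    (E : int -> set 'cV[R]_6) : Prop :=
  exists delta : int, forall (k1 : nat) (X : nat -> 'cV[R]_6),
    closed_loop A B K Xn delta k1 X ->
    E (k1%:Z + delta) (X k1) ->
    forall k2 : nat, (k1 <= k2)%N -> E (k2%:Z + delta) (X k2).

Lemma index_modK (k : int) : index_mod (index_mod k : nat)%:Z = index_mod k.
Proof.
apply: val_inj; rewrite /index_mod /=.
have ge0 : 0 <= (k %% kmax.+1%:Z)%Z by exact: modz_ge0.
have lt_k : (`|(k %% kmax.+1%:Z)%Z|%N < kmax.+1)%N.
  by rewrite -ltz_nat (gez0_abs ge0); exact: ltz_pmod.
by rewrite (inordK lt_k) (gez0_abs ge0) modz_mod (inordK lt_k).
Qed.

Lemma tube_section_subset A (X0 : 'cV[R]_6) P rho (k : int) :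
  tube_section A X0 P rho k `<=` tube (tube_section A X0 P rho).
Proof.
move=> X EX; exists (index_mod k) => //.
by rewrite /tube_section /nmt /= index_modK.
Qed.

End Tube.

(* Main.v *)
Require Import Defs.
From mathcomp Require Import all_boot all_order all_algebra.
From mathcomp Require Import all_classical all_reals all_analysis.
From mathcomp Require Import ring.
Import Order.TTheory GRing.Theory Num.Theory.
Import numFieldNormedType.Exports.
Local Open Scope ring_scope.

(** Take the shift to be 0.  Along the closed loop the error between the state
and the trajectory obeys e(k+1) = Abar e(k), so the quadratic form of P at the
error decreases by the value of the quadratic form of Q ([quad_lyapunov_le]),
while the bound rho does not decrease; the state therefore passes from each
section of the tube to the next.

The error recursion requires X_n(k+1) = A X_n(k) for every k.  As the index of
X_n is reduced modulo N = kmax + 1, this holds across the wrap-around only if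
A^N X0 = X0: the discretized natural motion has to close up after one orbital
period ([iter_cw_A_period]).  The matrix Ac is annihilated by
X^2 (X^2 + omega^2): its eigenvalues are 0 and +- i omega, and the Jordan block
at 0 is the secular along-track drift.  Hence, for M = dT Ac and
theta = omega dT, every even power of M from the second on is a multiple of M^2
and every odd power from the third on a multiple of M^3, and the exponential
series sums to a combination of 1, M, M^2, M^3 with coefficients given by theta,
cos theta and sin theta ([expmx_trig]).  The condition
y'(0) = - 2 omega x(0) removes the drift: on such a vector M^3 acts as
- theta^2 M, the iterates of the exponential are given by cos (k theta) and
sin (k theta) ([iter_expmx]), and N theta = 2 pi. *)

Section TrigExp.
Variables (R : realType) (n : nat) (M : 'M[R]_n.+1) (theta : R).
Hypothesis theta_neq0 : theta != 0.
Hypothesis M4 : M ^+ 4 = - theta ^+ 2 *: M ^+ 2.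

(** The relation M^4 = - theta^2 M^2 makes M^(2j+2) and M^(2j+3) equal to
(- theta^2)^j times M^2 and M^3.  Only one of the two trigonometric coefficients
is nonzero at a given index, so both parities fit in one formula; it fails
at the indices 0 and 1. *)
Lemma expmx_term k :
  (k.+2`!%:R)^-1 *: M ^+ k.+2 =
  cos_coeff theta k.+2 *: (- (theta ^- 2) *: M ^+ 2)
  + sin_coeff theta k.+2 *: (- (theta ^- 3) *: M ^+ 3).
Proof.
have M_even j : M ^+ j.*2.+2 = (- theta ^+ 2) ^+ j *: M ^+ 2.
  elim: j => [|j IH]; first by rewrite scale1r.
  rewrite doubleS -[j.*2.+4]addn2 exprD IH -scalerAl -exprD M4 scalerA.
  by rewrite -exprSr.
rewrite /cos_coeff /sin_coeff /= negbK.
have k_fact_neq0 : (k.+2`!%:R : R) != 0 by rewrite pnatr_eq0 -lt0n fact_gt0.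
have [k_odd|k_even] := boolP (odd k).
- rewrite /= !mul0r scale0r add0r scalerA.
  have -> : M ^+ k.+2 = (- theta ^+ 2) ^+ k./2 *: M ^+ 3.
    by rewrite -{1}(odd_double_half k) k_odd exprS M_even -scalerAr -exprS.
  rewrite scalerA; congr (_ *: _).
  have -> : theta ^+ k.+2 = theta ^+ 3 * (theta ^+ 2) ^+ k./2.
    by rewrite -exprM mul2n -exprD -{1}(odd_double_half k) k_odd.
  have -> : uphalf k = k./2.+1 by rewrite uphalf_half k_odd.
  rewrite [(- theta ^+ 2) ^+ _]exprNn [_ ^+ k./2.+1]exprS.
  by field; rewrite theta_neq0.
- rewrite /= !mul0r scale0r addr0 scalerA.
  have -> : M ^+ k.+2 = (- theta ^+ 2) ^+ k./2 *: M ^+ 2.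
    by rewrite -M_even -{1}(odd_double_half k) (negbTE k_even).
  rewrite scalerA -exprnP; congr (_ *: _).
  have -> : theta ^+ k.+2 = theta ^+ 2 * (theta ^+ 2) ^+ k./2.
    by rewrite -exprM mul2n -exprD -{1}(odd_double_half k) (negbTE k_even).
  rewrite [(- theta ^+ 2) ^+ _]exprNn [_ ^+ k./2.+1]exprS.
  by field; rewrite theta_neq0.
Qed.

(** Here M^2 + theta^2 annihilates M^2 but in general not M, which is why a term
linear in theta accompanies the sine; it is the part of the flow that grows with
time. *)
Lemma expmx_trig :
  expmx M = 1 + M + ((1 - cos theta) / theta ^+ 2) *: M ^+ 2
                  + ((theta - sin theta) / theta ^+ 3) *: M ^+ 3.
Proof.
pose U := - (theta ^- 2) *: M ^+ 2; pose V := - (theta ^- 3) *: M ^+ 3.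
(* The constant part of S corrects the terms of index 0 and 1 of the two
   trigonometric series, so S gives the partial sums from index 2 on. *)
pose S k : 'M[R]_n.+1 := 1 + M - U - theta *: V
  + (series (cos_coeff theta) k *: U + series (sin_coeff theta) k *: V).
have partial_sum k :
    series (fun k => (k`!%:R)^-1 *: M ^+ k) (k + 2)%N = S (k + 2)%N.
  rewrite addn2; elim: k => [|k IH].
    rewrite /S /series /= !big_nat_recr //= !big_nil /cos_coeff /sin_coeff /=.
    rewrite !fact0 ?factS /= !expr0 !expr1 !invr1 ?divr1 !scale1r.
    rewrite !mul0r !mul1r !add0r !addr0 scale1r mulr1.
    apply/matrixP => i j; rewrite !mxE; ring.
  rewrite seriesSr IH /S !(seriesSr _ k.+2) expmx_term -/U -/V !scalerDl.
  apply/matrixP => i j; rewrite !mxE; ring.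
pose L : 'M[R]_n.+1 := 1 + M - U - theta *: V
  + (cos theta *: U + sin theta *: V).
have cvgS : (S k @[k --> \oo] --> L)%classic.
  apply: cvgD; first exact: cvg_cst.
  apply: cvgD; apply: cvgZr_tmp.
  - by rewrite unlock; exact: is_cvg_series_cos_coeff.
  - by rewrite unlock; exact: is_cvg_series_sin_coeff.
rewrite /expmx.
have -> : limn (series (fun k => (k`!%:R)^-1 *: M ^+ k)) = L.
  apply: cvg_lim => //; move: cvgS; rewrite -[X in X -> _](cvg_shiftn 2).
  by rewrite -[X in _ -> X](cvg_shiftn 2) -(funext partial_sum).
rewrite /L /U /V; apply/matrixP => i j; rewrite !mxE; field.
by rewrite theta_neq0.
Qed.

Variable v : 'cV[R]_n.+1.
Hypothesis v_periodic : M ^+ 3 *m v = - theta ^+ 2 *: (M *m v).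

(** When v has no drift component, M acts on M v and M^2 v as the generator of
a rotation of angle theta, and the angle addition formulas give the k-th
iterate. *)
Lemma iter_expmx k :
  iter k (mulmx (expmx M)) v =
  v + (sin (k%:R * theta) / theta) *: (M *m v)
    + ((1 - cos (k%:R * theta)) / theta ^+ 2) *: (M ^+ 2 *m v).
Proof.
elim: k => [|k IH].
  by rewrite /= mul0r sin0 cos0 subrr !mul0r !scale0r !addr0.
rewrite iterS {}IH -natr1 [(_ + 1) * theta]mulrDl mul1r sinD cosD expmx_trig.
have E1 : M *m (M *m v) = M ^+ 2 *m v by rewrite mulmxA.
have E2 : M *m (M ^+ 2 *m v) = - theta ^+ 2 *: (M *m v).
  by rewrite mulmxA -v_periodic.
have E3 w : M ^+ 2 *m w = M *m (M *m w) by rewrite mulmxA.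
have E4 w : M ^+ 3 *m w = M *m (M *m (M *m w)) by rewrite !mulmxA -(mulmxA M M M).
rewrite -idmxE !mulmxDl mul1mx -!scalemxAl.
rewrite !mulmxDr -!scalemxAr !E4.
rewrite [M ^+ 2 *m (M ^+ 2 *m v)]E3 [M ^+ 2 *m (M *m v)]E3.
rewrite !(E1, E2, =^~ scalemxAr).
apply/matrixP => i j; rewrite !mxE.
by field.
Qed.

End TrigExp.

Section ClohessyWiltshireMatrix.
Variables (R : realType) (omega : R).

Lemma big_ord6 (F : 'I_6 -> R) :
  \sum_i F i = F (inord 0) + F (inord 1) + F (inord 2)
             + F (inord 3) + F (inord 4) + F (inord 5).
Proof.
rewrite !big_ord_recl big_ord0 addr0 !addrA.
by do ![congr (_ + _)]; congr F; apply: val_inj; rewrite /= inordK.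
Qed.

Lemma ord6_ind (T : 'I_6 -> Prop) :
  T (inord 0) -> T (inord 1) -> T (inord 2) ->
  T (inord 3) -> T (inord 4) -> T (inord 5) -> forall i, T i.
Proof.
move=> T0 T1 T2 T3 T4 T5 i; rewrite -[i]inord_val.
by case: i => [[|[|[|[|[|[|]]]]]]].
Qed.

(** The equations of motion, row by row; they form a rewrite rule that evaluates
any entry of an iterated product by the matrix. *)
Lemma cw_AcE p (N : 'M[R]_(6, p)) j :
  let AN := cw_Ac omega *m N in
  ((AN (inord 0) j = N (inord 3) j)%R *
   (AN (inord 1) j = N (inord 4) j)%R *
   (AN (inord 2) j = N (inord 5) j)%R *
   (AN (inord 3) j =
      3 * omega ^+ 2 * N (inord 0) j + 2 * omega * N (inord 4) j)%R *
   (AN (inord 4) j = - (2 * omega) * N (inord 3) j)%R *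
   (AN (inord 5) j = - omega ^+ 2 * N (inord 2) j)%R)%type.
Proof.
by do !split; rewrite mxE big_ord6 !mxE !inordK //= !(mul0r, mul1r, add0r, addr0).
Qed.

(** The in-plane motion has characteristic polynomial X^2 (X^2 + omega^2) and
the out-of-plane motion X^2 + omega^2. *)
Lemma cw_Ac_exp4 : cw_Ac omega ^+ 4 = - omega ^+ 2 *: cw_Ac omega ^+ 2.
Proof.
set A := cw_Ac omega.
(* The identity factor lets the rows be unfolded down to numbers: the second row
   of the equation needs the entries of the innermost A. *)
have -> : A ^+ 4 = A *m (A *m (A *m (A *m 1%:M))) by rewrite mulmx1.
have -> : A ^+ 2 = A *m (A *m 1%:M) by rewrite mulmx1.
apply/matrixP => i j; rewrite [RHS]mxE; elim/ord6_ind: i; rewrite !cw_AcE; ring.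
Qed.

(** With y' = - 2 omega x the x-equation reduces to x'' = - omega^2 x, so every
velocity component oscillates at frequency omega. *)
Lemma cw_Ac_exp3_closed (X0 : 'cV[R]_6) : closed_nmt_init omega X0 ->
  cw_Ac omega ^+ 3 *m X0 = - omega ^+ 2 *: (cw_Ac omega *m X0).
Proof.
set A := cw_Ac omega; rewrite /closed_nmt_init => X0_4.
have -> : A ^+ 3 *m X0 = A *m (A *m (A *m X0)).
  by rewrite !mulmxA -(mulmxA A A A).
apply/matrixP => i j; rewrite (ord1 j) [RHS]mxE.
by elim/ord6_ind: i; rewrite !cw_AcE ?X0_4; ring.
Qed.

(** The iterates are the states at the times k dT of the continuous flow, which
has period 2 pi / omega from an initial state without drift. *)
Lemma iter_cw_A_period (dT : R) (N : nat) (X0 : 'cV[R]_6) :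
  0 < omega -> 0 < dT -> 2 * pi / omega / dT = N%:R ->
  closed_nmt_init omega X0 -> iter N (mulmx (cw_A omega dT)) X0 = X0.
Proof.
move=> omega_gt0 dT_gt0 period X0_closed.
have theta_neq0 : omega * dT != 0 by rewrite mulf_neq0 ?gt_eqF.
have M4 : (dT *: cw_Ac omega) ^+ 4 =
    - (omega * dT) ^+ 2 *: (dT *: cw_Ac omega) ^+ 2.
  rewrite ![(dT *: cw_Ac omega) ^+ _]exprZn cw_Ac_exp4 !scalerA; congr (_ *: _); ring.
have v_periodic : (dT *: cw_Ac omega) ^+ 3 *m X0 =
    - (omega * dT) ^+ 2 *: ((dT *: cw_Ac omega) *m X0).
  rewrite exprZn -!scalemxAl cw_Ac_exp3_closed // !scalerA; congr (_ *: _); ring.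
rewrite /cw_A (iter_expmx _ _ _ _ theta_neq0 M4 _ v_periodic).
have -> : N%:R * (omega * dT) = pi *+ 2.
  by rewrite -period -mulr_natl; field; rewrite !gt_eqF.
by rewrite sin2pi cos2pi subrr !mul0r !scale0r !addr0.
Qed.

End ClohessyWiltshireMatrix.

Lemma index_mod_nat (kmax k : nat) :
  index_mod kmax k%:Z = (k %% kmax.+1)%N :> nat.
Proof. by rewrite /index_mod modz_nat absz_nat inordK // ltn_pmod. Qed.

(** Periodicity makes the reduction of the index invisible, so that the
trajectory satisfies the natural dynamics at the wrap-around too. *)
Lemma nmt_natE (R : realType) (kmax : nat) (A : 'M[R]_6) (X0 : 'cV[R]_6) :
  iter kmax.+1 (mulmx A) X0 = X0 ->
  forall k : nat, nmt kmax A X0 k%:Z = iter k (mulmx A) X0.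
Proof.
move=> AX0 k; rewrite /nmt index_mod_nat [in RHS](divn_eq k kmax.+1) addnC iterD.
congr iter; elim: (k %/ _)%N => [//|q IH].
by rewrite mulSn iterD -IH AX0.
Qed.

Lemma quad_lyapunov_le (R : realType) n (A P Q : 'M[R]_n) (e : 'cV[R]_n) :
  sym_posdef Q -> A^T *m P *m A - P = - Q -> quad P (A *m e) <= quad P e.
Proof.
move=> [_ Q_gt0] lyapunov.
have Q_ge0 : 0 <= quad Q e.
  have [->|/Q_gt0/ltW //] := eqVneq e 0.
  by rewrite /quad mulmx0 mxE.
suff -> : quad P (A *m e) = quad P e - quad Q e by rewrite gerBl.
rewrite /quad -[Q]opprK -lyapunov opprB mulmxBr mulmxBl trmx_mul !mulmxA !mxE.
by rewrite opprB addrC subrK.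
Qed.

Theorem theorem1 (R : realType) (omega m dT : R) (kmax : nat)
    (X0 : 'cV[R]_6) (K : 'M[R]_(3, 6)) (P Q : 'M[R]_6)
    (rho : 'I_kmax.+1 -> R)
    (omega_gt0 : 0 < omega) (m_gt0 : 0 < m) (dT_gt0 : 0 < dT)
    (period : 2 * pi / omega / dT = kmax.+1%:R)
    (X0_closed : closed_nmt_init omega X0)
    (Abar_schur : schur (cw_A omega dT + cw_B omega m dT *m K))
    (rho_ge0 : forall k : 'I_kmax.+1, 0 <= rho k)
    (P_posdef : sym_posdef P)
    (Q_posdef : sym_posdef Q)
    (lyapunov :
      (cw_A omega dT + cw_B omega m dT *m K)^T *m P
        *m (cw_A omega dT + cw_B omega m dT *m K) - P = - Q)
    (rho_mono : forall k1 k2 : nat, (k1 <= k2)%N ->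
      rho (index_mod kmax k1%:Z) <= rho (index_mod kmax k2%:Z)) :
  tube_positively_invariant (cw_A omega dT) (cw_B omega m dT) K
    (nmt kmax (cw_A omega dT) X0)
    (tube_section (cw_A omega dT) X0 P rho).
Proof.
have nmtE := nmt_natE _ _ _ _
  (iter_cw_A_period _ _ _ _ _ omega_gt0 dT_gt0 period X0_closed).
exists 0 => k1 X X_loop; rewrite addr0 => X_k1 k2 /subnK <-; rewrite addr0.
elim: (k2 - k1)%N => [//|j IH]; rewrite addSn; set k := (j + k1)%N in IH *.
rewrite /tube_section /= in IH *.
have -> : X k.+1 - nmt kmax (cw_A omega dT) X0 k.+1%:Z =
    (cw_A omega dT + cw_B omega m dT *m K)
      *m (X k - nmt kmax (cw_A omega dT) X0 k%:Z).
  rewrite X_loop ?leq_addl // addr0 !nmtE iterS mulmxBr.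
  rewrite (mulmxDl _ _ (iter _ _ _)).
  by rewrite opprD addrA addrAC.
apply: le_trans (quad_lyapunov_le _ _ _ _ _ _ Q_posdef lyapunov) _.
exact: le_trans IH (rho_mono _ _ (leqnSn k)).
Qed.
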